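(* Let $(C,0)=(\bigcup_{i=1}^rC_i,0)\subset(\mathbb{C}^2,0)$ be a reduced plane curve singularity with irreducible components $C_1,\ldots,C_r$, $K_0=\{1,\ldots,r\}$, and let $P_{C_K}=\sum_v\pi^K_vt^v$ be the Poincaré series of $C_K=\bigcup_{i\in K}C_i$ for $K\subset K_0$. Consider a formal series $G(t_1,\ldots,t_r)=\sum_{v\in\mathbb{Z}^r}g(v)\,t_1^{v_1}\cdots t_r^{v_r}\in\mathbb{Z}[[t_1,t_1^{-1},\ldots,t_r,t_r^{-1}]]$ with the following properties: (a) $g(v)=g(\max\{v,0\})$ for all $v$ (coordinatewise maximum); (b) $g(0)=0$; (c) for any $K=\{i_1,\ldots,i_{|K|}\}\subset K_0$ and any $v=(v_{i_1},\ldots,v_{i_{|K|}})\in\mathbb{Z}^{K}$, extended to a vector in $\mathbb{Z}^r$ by setting the entries indexed by $K_0\setminus K$ to be zero, $$\pi^K_v=\sum_{M\subset K}(-1)^{|M|-1}g(v+e_M).$$ Then $G$ is uniquely determined by $\{P_{C_K}\}_{K}$ (hence by $P=P_{C}$ too), and it satisfies $$G(t_1,\ldots,t_r)\big|_{0\preceq v}=\frac{1}{\prod_{i=1}^r(1-t_i)}\sum_{K\subset K_0}(-1)^{|K|-1}\Big(\prod_{i\in K}t_i\Big)\cdot P_{C_K}(t_{i_1},\ldots,t_{i_{|K|}}).$$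
   Context: For $v\in\mathbb{Z}^r$, $0\preceq v$ means $v_i\ge0$ for all $i$, and $G|_{0\preceq v}=\sum_{0\preceq v}g(v)t^v$. $e_i$ are the basis vectors and $e_M=\sum_{i\in M}e_i$. For a reduced plane curve germ with components indexed by $K\ne\emptyset$ and normalizations $\gamma_i:(\mathbb{C},0)\to(C_i,0)$ ($i\in K$), put $\mathfrak{v}_i(f)=\mathrm{ord}_tf(\gamma_i(t))$ for $f\in\mathcal{O}=\mathcal{O}_{\mathbb{C}^2,0}$, $J^K(v)=\{f:\mathfrak{v}_i(f)\ge v_i,\ i\in K\}$ and $h^K(v)=\dim_{\mathbb{C}}\mathcal{O}/J^K(v)$ for $v\in\mathbb{Z}^K$. The Hilbert series is $H_{C_K}(t)=\sum_vh^K(v)t^v$ and the Poincaré series is $P_{C_K}(t)=-H_{C_K}(t)\prod_{i\in K}(1-t_i^{-1})=\sum_v\pi^K_vt^v$, i.e. $\pi^K_v=\sum_{M\subset K}(-1)^{|M|-1}h^K(v+e_M)$; it is a power series in nonnegative powers of the $t_i$. For $K=\emptyset$ one sets $\pi^\emptyset_v=0$ (so $P_{C_\emptyset}=0$). It is known (Yamamoto, together with the theorem of Campillo–Delgado–Gusein-Zade identifying $P$ with the Alexander polynomial) that $P=P_C$ determines the embedded topological type of $C$, and hence all the series $P_{C_K}$. *)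

(* Defs.v *)
(* The field of complex numbers is R[i] for a realType R. *)
From HB Require Import structures.
From mathcomp Require Import all_boot all_order all_algebra.
From mathcomp Require Import all_classical all_reals.
From mathcomp Require Import complex.

Set Implicit Arguments.
Unset Strict Implicit.
Unset Printing Implicit Defensive.

Import Order.TTheory GRing.Theory Num.Theory.
Local Open Scope classical_set_scope.
Local Open Scope complex_scope.
Local Open Scope ring_scope.

Section ConvergentPowerSeries.
Variable R : realType.
Local Notation C := R[i].

(* Power series in one and two variables, given by their coefficients. *)
Definition ps1 := nat -> C.
Definition ps2 := nat -> nat -> C.

(* The rings C{t} and C{x,y}: series that converge absolutely on some disc,
   respectively bidisc, centred at the origin, i.e. whose partial sums of
   absolute values are bounded there. *)
Definition conv1 : set ps1 := [set a : ps1 | exists rho B : R, 0 < rho /\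
  forall N : nat, \sum_(i < N) `|a i| * rho%:C ^+ i <= B%:C].
Definition conv2 : set ps2 := [set f : ps2 | exists rho B : R, 0 < rho /\
  forall N : nat,
    \sum_(i < N) \sum_(j < N) `|f i j| * rho%:C ^+ (i + j) <= B%:C].

Definition mul1 (a b : ps1) : ps1 :=
  fun n => \sum_(k < n.+1) a k * b (n - k)%N.
Definition one1 : ps1 := fun n => (n == 0)%:R.
Definition exp1 (a : ps1) (k : nat) : ps1 := iter k (mul1 a) one1.

Definition mul2 (f g : ps2) : ps2 :=
  fun m n => \sum_(k < m.+1) \sum_(l < n.+1) f k l * g (m - k)%N (n - l)%N.
Definition one2 : ps2 := fun m n => ((m == 0) && (n == 0))%:R.

(* f(x(t), y(t)).  Only used when x(0) = y(0) = 0: then x^i y^j has order at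
   least i + j, so the monomials with i > n or j > n do not contribute to the
   coefficient of t^n. *)
Definition pullback (gamma : ps1 * ps1) (f : ps2) : ps1 :=
  fun n => \sum_(i < n.+1) \sum_(j < n.+1)
    f i j * mul1 (exp1 gamma.1 i) (exp1 gamma.2 j) n.

(* The order in t, with ord 0 = +oo. *)
Definition ord (a : ps1) : \bar int :=
  if pselect (exists n, a n != 0) is left e then ((ex_minn e)%:Z)%:E else +oo%E.

Definition unit2 (u : ps2) : Prop :=
  conv2 u /\ exists2 w, conv2 w & mul2 u w = one2.

Definition irreducible2 (f : ps2) : Prop :=
  [/\ conv2 f, f <> (fun _ _ => 0), ~ unit2 f &
      forall g h, conv2 g -> conv2 h -> f = mul2 g h -> unit2 g \/ unit2 h].

Definition associated2 (f g : ps2) : Prop :=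
  exists2 u, unit2 u & f = mul2 u g.

(* gamma is a normalization of the branch {f = 0}: the pullback along gamma
   induces an injection of C{x,y}/(f) into C{t} that identifies C{t} with
   the integral closure of C{x,y}/(f) in its field of fractions: the extension
   has the same field of fractions and is integral, and C{t}, a discrete
   valuation ring, is integrally closed. *)
Record is_normalization (f : ps2) (gamma : ps1 * ps1) : Prop := {
  norm_conv : conv1 gamma.1 /\ conv1 gamma.2;
  norm_origin : gamma.1 0%N = 0 /\ gamma.2 0%N = 0;
  norm_ker : forall g, conv2 g ->
    pullback gamma g = (fun=> 0) <-> exists2 h, conv2 h & g = mul2 f h;
  norm_birational : forall phi, conv1 phi -> exists g h : ps2,
    [/\ conv2 g, conv2 h, pullback gamma h <> (fun=> 0) &
        mul1 phi (pullback gamma h) = pullback gamma g];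
  norm_integral : forall phi, conv1 phi ->
    exists (d : nat) (c : nat -> ps2), (forall k, conv2 (c k)) /\
      exp1 phi d =
        (fun n => \sum_(k < d) mul1 (pullback gamma (c k)) (exp1 phi k) n)
}.

(* dim_C C{x,y}/J = n: C{x,y}/J has a basis of n elements. *)
Definition has_codim (J : set ps2) (n : nat) : Prop :=
  exists b : 'I_n -> ps2, (forall k, conv2 (b k)) /\
    forall f, conv2 f -> exists! c : 'rV[C]_n,
      J (fun p q => f p q - \sum_(k < n) c 0 k * b k p q).

Definition codim (J : set ps2) : nat := xget 0%N [set n | has_codim J n].

(* A reduced plane curve germ with irreducible components indexed by I and a
   normalization of each component.  Irreducible equations define the same
   component iff they are associated. *)
Record plane_curve (I : finType) := PlaneCurve {
  equation : I -> ps2;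
  param : I -> ps1 * ps1;
  equation_irreducible : forall i, irreducible2 (equation i);
  equation_distinct : forall i j,
    i != j -> ~ associated2 (equation i) (equation j);
  param_normalization : forall i, is_normalization (equation i) (param i)
}.

End ConvergentPowerSeries.

(* The union C_K of the components indexed by K. *)
Section Subcurve.
Variables (R : realType) (I : finType) (X : plane_curve R I) (K : {set I}).

Lemma subcurve_distinct (i j : {k | k \in K}) : i != j ->
  ~ associated2 (equation X (val i)) (equation X (val j)).
Proof. by move=> ij; apply: equation_distinct; rewrite (inj_eq val_inj). Qed.

Definition subcurve : plane_curve R {k | k \in K} :=
  PlaneCurve (fun i => equation_irreducible X (val i)) subcurve_distinct
             (fun i => param_normalization X (val i)).
End Subcurve.

(* Z[[t_i, t_i^-1 : i in I]], given by coefficients. *)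
Definition laurent (I : finType) := {ffun I -> int} -> int.

Definition evec (I : finType) (M : {set I}) : {ffun I -> int} :=
  [ffun i => (i \in M)%:R].

Section Poincare.
Variables (R : realType) (I : finType) (X : plane_curve R I).

Definition valuation (i : I) (f : ps2 R) : \bar int :=
  ord (pullback (param X i) f).

Definition valuation_ideal (v : {ffun I -> int}) : set (ps2 R) :=
  [set f : ps2 R | conv2 f /\ forall i, ((v i)%:E <= valuation i f)%E].

Definition hilbert (v : {ffun I -> int}) : nat := codim (valuation_ideal v).

(* The sign (-1)^(|M|-1) is written (-1)^(|M|+1), so that it makes sense (and
   equals -1) for empty M. *)
Definition poincare : laurent I := fun v =>
  if #|I| == 0%N then 0
  else \sum_(M : {set I}) (-1) ^+ #|M|.+1 * (hilbert (v + evec M))%:Z.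

End Poincare.

Section LaurentSeries.
Variable I : finType.
Implicit Types (A B F : laurent I) (K M : {set I}) (v : {ffun I -> int}).

(* The Cauchy product, meaningful when every coefficient is a sum with finitely
   many nonzero terms; this is so when one factor is a Laurent polynomial, or
   when both factors have only nonnegative exponents. *)
Definition smul A B : laurent I :=
  fun v => \sum_(u \in [set: {ffun I -> int}]) A u * B (v - u).

Definition monom (w : {ffun I -> int}) : laurent I := fun v => (v == w)%:R.

Definition nonneg v : bool := [forall i, 0 <= v i].

Definition nonneg_part F : laurent I := fun v => if nonneg v then F v else 0.

(* The expansion of 1 / \prod_i (1 - t_i) in nonnegative powers; see
   inv_prod_one_subE. *)
Definition inv_prod_one_sub : laurent I := nonneg_part (fun=> 1).

Definition one_sub (i : I) : laurent I :=
  fun v => monom 0 v - monom (evec [set i]) v.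

Definition extend K (v : {ffun {k | k \in K} -> int}) : {ffun I -> int} :=
  [ffun i => if insub i is Some k then v k else 0].

(* A series in the variables t_i, i in K, seen as a series in all t_i. *)
Definition inflate K (F : laurent {k | k \in K}) : laurent I :=
  fun v => if [forall i, (i \notin K) ==> (v i == 0)]
           then F [ffun k => v (val k)] else 0.

Lemma smul_monom w F v : smul (monom w) F v = F (v - w).
Proof.
rewrite /smul -(fsbig_widen [set w]) ?fsbig_set1 /monom ?eqxx ?mul1r//.
by move=> u [_ /= uw]; case: eqP => [/uw//|_]; rewrite mul0r.
Qed.

Lemma smul_one_sub i F v : smul (one_sub i) F v = F v - F (v - evec [set i]).
Proof.
pose D := [set 0; evec [set i]].
have ne : evec [set i] != 0.
  by apply/eqP => /ffunP/(_ i); rewrite !ffunE inE eqxx.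
rewrite /smul -(fsbig_widen D)//; last first.
  move=> u [_ Du] /=; rewrite /one_sub /monom.
  have [u0|_] := eqVneq u 0; first by case: Du; left.
  have [u1|_] := eqVneq u (evec [set i]); first by case: Du; right.
  by rewrite subrr mul0r.
rewrite fsbigU0 ?fsbig_set1//=.
  by rewrite /one_sub /monom !eqxx eq_sym (negPf ne) subr0 mul1r sub0r mulN1r subr0.
by move=> u [/= -> /esym/eqP]; rewrite (negPf ne).
Qed.

Lemma inv_prod_one_subE :
  foldr (fun i => smul (one_sub i)) inv_prod_one_sub (enum I) =1 monom 0.
Proof.
have key s v : uniq s ->
    foldr (fun i => smul (one_sub i)) inv_prod_one_sub s v =
    [forall i, if i \in s then v i == 0 else 0 <= v i]%:R.
  elim: s v => [|i s IHs] v /=.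
    by rewrite /inv_prod_one_sub /nonneg_part /nonneg; case: ifP.
  move=> /andP[nis us]; rewrite smul_one_sub !IHs//.
  pose Q := [forall j, (j != i) ==> (if j \in s then v j == 0 else 0 <= v j)].
  have E (w : {ffun I -> int}) (p : bool) (T : pred I) :
     (forall j, j != i -> T j = (if j \in s then v j == 0 else 0 <= v j)) ->
     T i = p -> [forall j, T j] = p && Q.
    move=> Tj Ti; apply/forallP/andP => [H|[pT /forallP q] j].
      split; first by rewrite -Ti.
      by apply/forallP => j; apply/implyP => ji; rewrite -Tj.
    have [->|ji] := eqVneq j i; first by rewrite Ti.
    by rewrite Tj//; have /implyP/(_ ji) := q j.
  rewrite (E v (0 <= v i)) ?(negPf nis)//.
  rewrite (E v (1 <= v i)); last 2 first.
  - by move=> j ji; rewrite !ffunE inE (negPf ji) subr0.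
  - by rewrite (negPf nis) !ffunE inE eqxx subr_ge0.
  rewrite (E v (v i == 0)); last 2 first.
  - by move=> j ji; rewrite inE (negPf ji).
  - by rewrite inE eqxx.
  by case: {E}Q; rewrite ?andbF ?andbT//; case: (v i) => [[|n]|n].
move=> v; rewrite key ?enum_uniq// /monom; congr ((nat_of_bool _)%:R).
apply/forallP/eqP => [H|-> i]; last by rewrite mem_enum ffunE eqxx.
by apply/ffunP => i; have := H i; rewrite mem_enum ffunE => /eqP.
Qed.

End LaurentSeries.

Section Properties.
Variables (R : realType) (r : nat) (X : plane_curve R 'I_r) (G : laurent 'I_r).

Record admissible : Prop := {
  admissible_max : forall v, G v = G [ffun i => Num.max (v i) 0];
  admissible_zero : G 0 = 0;
  admissible_poincare : forall (K : {set 'I_r}) (v : {ffun {k | k \in K} -> int}),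
    poincare (subcurve X K) v =
    \sum_(M : {set 'I_r} | M \subset K)
       (-1) ^+ #|M|.+1 * G (extend v + evec M)
}.
End Properties.

(* The known theorem of Yamamoto and Campillo, Delgado and Gusein-Zade, in the
   form in which it is used: the Poincare series of a curve with r components
   determines the Poincare series of all its subcurves. *)
Definition poincare_determines_subcurves (R : realType) (r : nat) : Prop :=
  forall X Y : plane_curve R 'I_r, poincare X =1 poincare Y ->
  forall K : {set 'I_r}, poincare (subcurve X K) =1 poincare (subcurve Y K).

(* Main.v *)
(* Write D for multiplication by \prod_i (1 - t_i).
   By (a), the coefficients of P_{C_K} with a negative exponent cancel in (c),
   so in the numerator of the formula only the set K of indices i with v_i > 0
   contributes to the coefficient of t^v. For that K, substituting N = K \ M in
   (c) turns the contribution into \sum_{N \subset K} (-1)^|N| g(v - e_N), which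
   is the coefficient of t^v in D applied to the nonnegative part of G.
   Dividing by D gives the formula; with (a), it determines G. *)
Require Import Defs.
From HB Require Import structures.
From mathcomp Require Import all_boot all_order all_algebra.
From mathcomp Require Import all_classical all_reals.
From mathcomp Require Import finmap zify.

Set Implicit Arguments.
Unset Strict Implicit.
Unset Printing Implicit Defensive.

Import Order.TTheory GRing.Theory Num.Theory.
Local Open Scope ring_scope.

(** Pair each [M] avoiding [i] with [i |: M]: equal values, opposite signs, so each pair cancels. *)
Lemma sum_sign_toggle (I : finType) (i : I) (F : {set I} -> int) :
  (forall M : {set I}, i \notin M -> F (i |: M) = F M) ->
  \sum_(M : {set I}) (-1) ^+ #|M| * F M = 0.
Proof.
move=> Fi; rewrite (bigID (fun M : {set I} => i \in M))/=.
rewrite (reindex_onto (fun M : {set I} => i |: M)%SET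
  (fun M => M :\ i)%SET) /=; last first.
  by move=> M iM; rewrite finset.setD1K.
rewrite (eq_bigl (fun M : {set I} => i \notin M)); last first.
  move=> M; rewrite setU11/=; apply/eqP/idP => [<-|iM]; first by rewrite setD11.
  by rewrite finset.setU1K.
rewrite -big_split big1//= => M iM.
by rewrite Fi// cardsU1 iM exprS mulN1r mulNr addNr.
Qed.

(** * Multiplying and dividing by the product of the $1-t_i$ *)

Section Laurent.
Variable I : finType.
Implicit Types (A B H : laurent I) (K M N : {set I}) (u v w : {ffun I -> int}).
Local Open Scope classical_set_scope.

Lemma evec0 : evec (finset.set0 : {set I}) = 0.
Proof. by apply/ffunP => i; rewrite !ffunE inE. Qed.

Lemma evecD K M : M \subset K -> evec (K :\: M) = evec K - evec M.
Proof.
move=> /fintype.subsetP MK; apply/ffunP => i; rewrite !ffunE inE.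
by case: (boolP (i \in M)) => [/MK->//|_]; rewrite subr0.
Qed.

Lemma evec_ge0 M i : 0 <= evec M i.
Proof. by rewrite ffunE ler0n. Qed.

Lemma nonneg_subr v u : nonneg u -> nonneg (v - u) -> nonneg v.
Proof.
move=> /forallP u0 /forallP vu0; apply/forallP => i.
by have := vu0 i; rewrite !ffunE subr_ge0; apply: le_trans.
Qed.

Lemma nonneg_evec M : nonneg (evec M).
Proof. by apply/forallP => i; exact: evec_ge0. Qed.

(** The exponents [u] that can contribute to the coefficient of $t^v$ when both factors have only
    nonnegative exponents. *)
Definition box v : set {ffun I -> int} := [set u | nonneg u /\ nonneg (v - u)].

Lemma box_finite v : finite_set (box v).
Proof.
(* [n] bounds all coordinates at once, so the box lies in the image of a finite type of
   functions. *)
pose n := (\sum_i `|v i|)%N.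
pose h (x : {ffun I -> 'I_n.+1}) : {ffun I -> int} :=
  [ffun i => (x i : nat)%:Z].
apply: (@sub_finite_set _ _ (h @` setT)); last exact/finite_image/finite_finset.
move=> u [/forallP u0 /forallP uv]; exists [ffun i => inord `|u i|%N] => //.
apply/ffunP => i; rewrite !ffunE inordK.
  by rewrite gez0_abs.
have : (`|v i| <= n)%N by rewrite /n (bigD1 i)//= leq_addr.
by have := uv i; have := u0 i; rewrite !ffunE; move: (u i) (v i) => a b; lia.
Qed.

Definition nonneg_supported A := forall v, ~~ nonneg v -> A v = 0.

(** Off the box one of the factors vanishes. The resulting finite index set depends on [v] alone, so
    sums can be exchanged. *)
Lemma smul_box A B v : nonneg_supported A -> nonneg_supported B ->
  smul A B v = \sum_(u <- fset_set (box v)) A u * B (v - u).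
Proof.
move=> A0 B0; rewrite -(fsbig_finite _ _ (box_finite v)).
apply/esym/fsbig_widen => // u [_ /= ub].
have [u0|u0] := boolP (nonneg u); last by rewrite A0 ?mul0r.
by rewrite B0 ?mulr0//; apply/negP => uv0; apply: ub.
Qed.

Lemma smul_shift A B w v :
  smul A (fun v => B (v - w)) v = smul (fun u => A (u - w)) B v.
Proof.
rewrite /smul [RHS](reindex_fsbigT (fun u => u + w)).
  by apply: eq_fsbigr => u _ /=; rewrite addrK opprD addrA.
by exists (fun u => u - w) => u; rewrite ?addrK ?subrK.
Qed.

Lemma inv_prod_one_sub_supported : nonneg_supported (@inv_prod_one_sub I).
Proof. by move=> v /negPf v0; rewrite /inv_prod_one_sub /nonneg_part v0. Qed.

Lemma supported_shift A M : nonneg_supported A ->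
  nonneg_supported (fun v => A (v - evec M)).
Proof.
move=> A0 v v0; apply: A0; apply: contra v0; apply: nonneg_subr.
exact: nonneg_evec.
Qed.

(** The operator $D$: $\prod_i(1-t_i)$ expanded over subsets as $\sum_N(-1)^{|N|}t^{e_N}$, applied
    to [H]. *)
Definition difference H : laurent I :=
  fun v => \sum_(N : {set I}) (-1) ^+ #|N| * H (v - evec N).

Lemma difference_supported H :
  nonneg_supported H -> nonneg_supported (difference H).
Proof.
by move=> H0 v v0; apply: big1 => N _; rewrite (supported_shift _ H0)// mulr0.
Qed.

(** At $u=0$ only the empty [N] leaves a nonnegative exponent. If $u_i>0$, putting [i] into [N] does
    not affect nonnegativity, so the terms cancel in pairs. *)
Lemma difference_inv_prod_one_sub u : nonneg u ->
  difference (@inv_prod_one_sub I) u = monom 0 u.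
Proof.
move=> /forallP u0; rewrite /monom; case: eqVneq => [->|/eqP u_neq0].
  rewrite /difference (bigD1 finset.set0)//= big1 ?addr0.
    rewrite cards0 evec0 subr0 expr0 mul1r /inv_prod_one_sub /nonneg_part ifT//.
    by apply/forallP => i; rewrite ffunE.
  move=> N /set0Pn[i iN]; rewrite inv_prod_one_sub_supported ?mulr0//.
  by apply/negP => /forallP/(_ i); rewrite !ffunE iN.
have [i ui] : exists i, u i != 0.
  apply/existsP; apply: contra_notT u_neq0 => /existsPn uE.
  by apply/ffunP => i; rewrite ffunE; apply/eqP/negPn.
apply: (sum_sign_toggle (i := i)) => N iN.
rewrite /inv_prod_one_sub /nonneg_part; congr (if _ then _ else _).
apply: eq_forallb => j; rewrite !ffunE !inE.
have [->|//] := eqVneq j i; rewrite (negPf iN) /=.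
by move: (u0 i) ui; move: (u i) => a; lia.
Qed.

(** The shifts making up $D$ are moved from [H] to the series of $1/\prod_i(1-t_i)$, which $D$ turns
    into $1$. *)
Lemma smul_inv_prod_difference H : nonneg_supported H ->
  smul (@inv_prod_one_sub I) (difference H) =1 H.
Proof.
move=> H0 v; have P0 := inv_prod_one_sub_supported.
transitivity (\sum_(N : {set I}) (-1) ^+ #|N| *
    smul (@inv_prod_one_sub I) (fun v => H (v - evec N)) v).
  rewrite (smul_box _ P0 (difference_supported H0)).
  under eq_bigr do rewrite big_distrr/=.
  rewrite exchange_big/=; apply: eq_bigr => N _.
  rewrite (smul_box _ P0 (supported_shift _ H0)) big_distrr/=.
  by apply: eq_bigr => u _; rewrite mulrCA.
transitivity (smul (monom 0) H v); last by rewrite smul_monom subr0.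
have m0 : nonneg_supported (monom (0 : {ffun I -> int})).
  move=> u; rewrite /monom; case: eqP => // -> /negP[].
  by apply/forallP => i; rewrite ffunE.
rewrite (smul_box _ m0 H0).
transitivity (\sum_(u <- fset_set (box v))
    difference (@inv_prod_one_sub I) u * H (v - u)).
  under eq_bigr => N _.
    rewrite smul_shift (smul_box _ (supported_shift _ P0) H0) big_distrr/=.
    over.
  rewrite exchange_big/=; apply: eq_bigr => u _; rewrite big_distrl/=.
  by apply: eq_bigr => N _; rewrite mulrA.
apply: eq_big_seq => u; rewrite in_fset_set; last exact: box_finite.
by move=> /set_mem[u0 _]; rewrite difference_inv_prod_one_sub.
Qed.

End Laurent.

(** * The formula for the nonnegative part of $G$ *)

Section Admissible.
Variables (R : realType) (r : nat) (X : plane_curve R 'I_r) (G : laurent 'I_r).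
Hypothesis hG : admissible X G.
Implicit Types (K M N : {set 'I_r}) (v : {ffun 'I_r -> int}).

Lemma inflate_poincareE K v :
  inflate (poincare (subcurve X K)) v =
  if [forall i, (i \notin K) ==> (v i == 0)]
  then \sum_(M : {set 'I_r} | M \subset K) (-1) ^+ #|M|.+1 * G (v + evec M)
  else 0.
Proof.
rewrite /inflate; case: ifPn => // /forallP vK.
rewrite (admissible_poincare hG); apply: eq_bigr => M _; congr (_ * G (_ + _)).
apply/ffunP => i; rewrite ffunE; case: insubP => [k _ <-|iK]; rewrite ?ffunE//.
by have /implyP/(_ iK)/eqP-> := vK i.
Qed.

(** Let $v_i<0$. Then $v_i$ and $v_i+1$ are both at most $0$, so by (a) the value $g(v+e_M)$ does
    not depend on whether $i\in M$, and the sum in (c) cancels. *)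
Lemma inflate_poincare_supported K :
  nonneg_supported (inflate (poincare (subcurve X K))).
Proof.
move=> v /forallPn[i vi]; rewrite inflate_poincareE.
case: ifPn => // /forallP vK.
have iK : i \in K.
  by apply: contraNT vi => iK; have /implyP/(_ iK)/eqP-> := vK i.
rewrite big_mkcond/= -[RHS]oppr0.
(* Extension by zero to all subsets; as $i\in K$, toggling [i] preserves $M\subset K$. *)
pose F M := if M \subset K then G (v + evec M) else 0.
rewrite -[in RHS](sum_sign_toggle (i := i) (F := F)) => [|M iM].
  rewrite -sumrN; apply: eq_bigr => M _; rewrite /F.
  by case: ifP => _; rewrite ?mulr0 ?oppr0// exprS mulN1r mulNr.
rewrite /F finset.subUset finset.sub1set iK/=; case: ifP => // _.
rewrite (admissible_max hG) [RHS](admissible_max hG); congr G.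
apply/ffunP => j; rewrite !ffunE !inE.
have [->|//] := eqVneq j i; rewrite (negPf iM)/=.
by move: vi; move: (v i) => a; lia.
Qed.

Lemma numerator_difference v :
  \sum_(K : {set 'I_r}) (-1) ^+ #|K|.+1 *
    smul (monom (evec K)) (inflate (poincare (subcurve X K))) v =
  difference (nonneg_part G) v.
Proof.
have G0 : nonneg_supported (nonneg_part G).
  by move=> w /negPf w0; rewrite /nonneg_part w0.
have [v0|v0] := boolP (nonneg v); last first.
  rewrite (difference_supported G0)//; apply: big1 => K _; rewrite smul_monom.
  by rewrite (supported_shift _ (@inflate_poincare_supported K))// mulr0.
(* Since [v] is nonnegative, this is the set where $v_i>0$. *)
pose S := [set i | v i != 0]%SET.
rewrite (bigD1 S)//= big1 ?addr0 => [|K KS]; last first.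
  rewrite smul_monom; have [i iKS] : exists i, (i \in K) != (i \in S).
    apply/existsP; apply: contraNT KS => /existsPn H.
    by apply/eqP/setP => i; apply/eqP/negPn.
  (* If $i\in K\setminus S$, then $v-e_K$ has entry $-1$ at [i]; if $i\in S\setminus K$, it has a
     nonzero exponent in a variable absent from $P_{C_K}$. *)
  have [iK|iK] := boolP (i \in K).
    rewrite inflate_poincare_supported ?mulr0//.
    apply/negP => /forallP/(_ i); rewrite !ffunE iK.
    by move: iKS; rewrite iK inE; case: (eqVneq (v i) 0) => //= ->.
  rewrite inflate_poincareE ifF ?mulr0//; apply/negP => /forallP/(_ i).
  rewrite !ffunE (negPf iK) subr0 /=.
  by move: iKS; rewrite (negPf iK) inE; case: (eqVneq (v i) 0).
rewrite smul_monom inflate_poincareE ifT; last first.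
  apply/forallP => i; apply/implyP; rewrite inE negbK => /eqP vi.
  by rewrite !ffunE inE vi eqxx.
rewrite /difference [RHS](bigID (fun N => N \subset S))/=.
(* For [N] not inside [S], $v-e_N$ has an entry $-1$. *)
rewrite [X in _ = _ + X]big1 ?addr0.
  rewrite big_distrr/= [RHS](reindex_onto (finset.setD S) (finset.setD S))/=.
    apply: eq_big => [N|N NS].
      rewrite finset.subsetDl/= finset.setDDr finset.setDv finset.set0U.
      by apply/idP/eqP => [/finset.setIidPr//|<-]; exact: finset.subsetIl.
    (* Here [N] plays the role of $M$ in (c): $v-e_S+e_N=v-e_{S\setminus N}$, and $|S|+|N|$ has the
       parity of $|S\setminus N|$. *)
    rewrite mulrA -exprD addSn addnS !exprS !mulN1r opprK /nonneg_part.
    rewrite evecD// opprB addrA [X in G X]addrAC ifT.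
      congr (_ * _).
      rewrite cardsD (finset.setIidPr NS) -signr_odd -[RHS]signr_odd.
      by rewrite oddB ?oddD ?subset_leq_card.
    (* Nonnegativity of $v-e_{S\setminus N}$: $v_i\ge1$ on [S]. *)
    apply/forallP => i; rewrite !ffunE inE.
    move/forallP/(_ i): v0; move: (v i) => a.
    by case: (i \in N); case: eqP => /= [->//|]; lia.
  move=> N NS; rewrite finset.setDDr finset.setDv finset.set0U.
  exact/finset.setIidPr.
move=> N /fintype.subsetPn[i iN iS]; rewrite G0 ?mulr0//.
apply/negP => /forallP/(_ i); rewrite !ffunE iN.
by move: iS; rewrite inE negbK => /eqP->.
Qed.

Lemma nonneg_part_admissibleE :
  nonneg_part G =1
    smul (@inv_prod_one_sub 'I_r)
      (fun v => \sum_(K : {set 'I_r}) (-1) ^+ #|K|.+1 *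
         smul (monom (evec K)) (inflate (poincare (subcurve X K))) v).
Proof.
move=> v; rewrite (funext numerator_difference) smul_inv_prod_difference//.
by move=> w /negPf w0; rewrite /nonneg_part w0.
Qed.

Lemma admissible_nonneg_part v :
  G v = nonneg_part G [ffun i => Num.max (v i) 0].
Proof.
rewrite (admissible_max hG) /nonneg_part ifT//.
by apply/forallP => i; rewrite ffunE le_max lexx orbT.
Qed.

End Admissible.

(** * Uniqueness *)

(** By (a) each series is recovered from its nonnegative part, which the formula expresses through
    the Poincaré series. Allowing two curves makes this cover determination by $P$ alone, once the
    known theorem supplies equality for all subcurves. *)
Lemma admissible_unique (R : realType) (r : nat) (X Y : plane_curve R 'I_r)
    (G H : laurent 'I_r) :
  admissible X G -> admissible Y H ->
  (forall K : {set 'I_r},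
     poincare (subcurve X K) =1 poincare (subcurve Y K)) ->
  G =1 H.
Proof.
move=> hG hH eq_poincare v.
rewrite (admissible_nonneg_part hG) (admissible_nonneg_part hH).
rewrite (nonneg_part_admissibleE hG) (nonneg_part_admissibleE hH).
apply: eq_fsbigr => u _ /=; apply/congr1/eq_bigr => K _.
by rewrite (funext (eq_poincare K)).
Qed.

Theorem theorem3p4p3 (R : realType) (r : nat) (r_gt0 : (0 < r)%N)
    (C : plane_curve R 'I_r) (G : laurent 'I_r) (hG : admissible C G) :
  [/\ (forall (C' : plane_curve R 'I_r) (G' : laurent 'I_r),
         admissible C' G' ->
         (forall K : {set 'I_r},
            poincare (subcurve C' K) =1 poincare (subcurve C K)) ->
         G' =1 G),
      (poincare_determines_subcurves R r ->
       forall (C' : plane_curve R 'I_r) (G' : laurent 'I_r),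
         admissible C' G' -> poincare C' =1 poincare C -> G' =1 G) &
      nonneg_part G =1
        smul (@inv_prod_one_sub 'I_r)
          (fun v => \sum_(K : {set 'I_r}) (-1) ^+ #|K|.+1 *
             smul (monom (evec K)) (inflate (poincare (subcurve C K))) v)].
Proof.
split.
- move=> C' G' hG' eq_poincare.
  by apply: admissible_unique hG' hG eq_poincare.
- move=> determines C' G' hG' eq_poincare.
  by apply: admissible_unique hG' hG _; exact: determines.
- exact: nonneg_part_admissibleE hG.
Qed.
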